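(* Let $T$ be a tree with $n\geq 4$ vertices and $l\geq 3$ leaves. Then $$\operatorname{tr}(T)\geq 6\left\lfloor\frac{n-1}{l}\right\rfloor+2\min\{(n-1)\bmod l,\;3\}.$$ Moreover, this bound is tight for any given pair $n,l$: for all integers $n,l$ with $n\geq 4$ and $3\leq l\leq n-1$ there exists a tree $T$ with exactly $n$ vertices and exactly $l$ leaves such that $$\operatorname{tr}(T)= 6\left\lfloor\frac{n-1}{l}\right\rfloor+2\min\{(n-1)\bmod l,\;3\}.$$
   Context: All graphs are finite and simple. For a connected graph $G$, $d_G(u,v)$ denotes the length of a shortest path between $u$ and $v$ in $G$. For vertices $u,v,w\in V(G)$ put $d_G(u,v,w)=d_G(u,v)+d_G(u,w)+d_G(v,w)$. The triameter of a connected graph $G$ is $\operatorname{tr}(G)=\max\{d_G(u,v,w): u,v,w\in V(G)\}$ (the vertices $u,v,w$ are not required to be distinct). A tree is a connected graph without cycles; a leaf is a vertex of degree one. For integers $m\ge 0$ and $l\ge 1$, $m\bmod l\in\{0,\dots,l-1\}$ is the remainder of $m$ upon division by $l$. *)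

(* Defs.v *)
From mathcomp Require Import all_boot.

Set Implicit Arguments.
Unset Strict Implicit.
Unset Printing Implicit Defensive.

Record sgraph := SGraph {
  vertex :> finType;
  adj : rel vertex;
  adj_sym : symmetric adj;
  adj_irrefl : irreflexive adj }.

Section Graph.

Variable G : sgraph.

Definition path_of_length (k : nat) (u v : G) : bool :=
  [exists p : k.-tuple G,
    [&& path (@adj G) u p, uniq (u :: p) & last u p == v]].

(* The vertices of a path are distinct, so every path has length at most     *)
(* #|G| - 1; [dist u v] takes the junk value #|G| when no path joins u to v.  *)
Definition dist (u v : G) : nat :=
  find (fun k => path_of_length k u v) (iota 0 #|G|).

Definition dist3 (u v w : G) : nat := dist u v + dist u w + dist v w.

Definition triameter : nat :=
  \max_(u : G) \max_(v : G) \max_(w : G) dist3 u v w.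

Definition connected_graph : Prop := forall u v : G, connect (@adj G) u v.

(* [ucycle adj c] also holds when c is empty or lists the two ends of a      *)
(* single edge, hence the condition on [size c].                             *)
Definition acyclic_graph : Prop :=
  forall c : seq G, 2 < size c -> ~ ucycle (@adj G) c.

Definition is_tree : Prop := connected_graph /\ acyclic_graph.

Definition degree (v : G) : nat := #|[set w | adj v w]|.

Definition leaves : {set G} := [set v | degree v == 1].

End Graph.

(* Main.v *)
(* Let a, b be at maximal distance D, and let h be the largest distance from  *)
(* a vertex c to the path ab, so that d(a, b, c) = 2 (D + h) and 2 h <= D.    *)
(* The D + 1 vertices of the path, and at most h vertices for each of the     *)
(* l - 2 other leaves, exhaust the tree, hence n - 1 <= D + (l - 2) h.        *)
(* Write n - 1 = q l + r.  If h <= q this gives D + h >= 3 q + r; otherwise   *)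
(* D + h >= 3 h >= 3 q + 3.  Equality holds for the spider with l legs of     *)
(* lengths as equal as possible.                                              *)
Require Import Defs.
From mathcomp Require Import all_boot zify.

Set Implicit Arguments.
Unset Strict Implicit.
Unset Printing Implicit Defensive.

(** Simple paths in a tree are unique ([uniq_path_inj]), so a vertex has at most one neighbour
    closer to a given target ([closer_neighbor_inj]). After [between_or_closer], the argument about
    trees uses distances only: lying on a path is the equation [between], and the distance to the
    path ab is [detour]. The vertex count comes from two injections: a vertex of the path goes to
    its distance from a ([card_geodesic]), any other vertex to its detour and a leaf beyond it,
    different from a and b ([card_off_geodesic]). In the spider, r vertices have depth q + 1 and all
    others depth at most q, which bounds its triameter from above ([spider_triameter]); the general
    lower bound then gives equality. *)

Section Distance.

Variable G : sgraph.
Implicit Types (x y z u v w : G) (p q : seq G).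

(** * Shortest paths and the metric of a connected graph *)

Lemma path_of_lengthP k u v :
  reflect (exists p, [/\ path (@adj G) u p, uniq (u :: p), last u p = v & size p = k])
          (path_of_length k u v).
Proof.
apply: (iffP existsP) => [[p /and3P [pp up /eqP lp]]|[p [pp up lp /eqP sp]]].
  by exists p; rewrite size_tuple.
by exists (Tuple sp); apply/and3P; split; rewrite /= ?lp.
Qed.

Lemma size_uniq_path u p : uniq (u :: p) -> size p < #|G|.
Proof. by move/card_uniqP => /= <-; apply: max_card. Qed.

Lemma dist_le_path u p : path (@adj G) u p -> dist u (last u p) <= size p.
Proof.
case/shortenP => q pq uq sub.
have szq : size q <= size p by apply: uniq_leq_size => //; case/andP: uq.
apply: leq_trans szq; rewrite leqNgt; apply/negP => lt_q.
have szG := size_uniq_path uq.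
have := before_find 0 lt_q; rewrite nth_iota // add0n /= => /negbT/negP; apply.
by apply/path_of_lengthP; exists q.
Qed.

Lemma distxx u : dist u u = 0.
Proof. by apply/eqP; rewrite -leqn0; apply: (@dist_le_path u [::]). Qed.

Lemma dist_adj u v : adj u v -> dist u v <= 1.
Proof. by move=> uv; apply: (@dist_le_path u [:: v]); rewrite /= uv. Qed.

Hypothesis conG : connected_graph G.

Lemma geodesicP u v :
  exists p, [/\ path (@adj G) u p, uniq (u :: p), last u p = v & size p = dist u v].
Proof.
apply/path_of_lengthP.
have /connectP [p0 pp0 ->] := conG u v; case/shortenP: pp0 => p pp up _.
have hasp : has (fun k => path_of_length k u (last u p)) (iota 0 #|G|).
  apply/hasP; exists (size p); first by rewrite mem_iota /= (size_uniq_path up).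
  by apply/path_of_lengthP; exists p.
have := nth_find 0 hasp; rewrite nth_iota //.
by move: hasp; rewrite has_find size_iota.
Qed.

Lemma dist_triangle v u w : dist u w <= dist u v + dist v w.
Proof.
have [p [pp _ lp <-]] := geodesicP u v; have [q [pq _ lq <-]] := geodesicP v w.
by rewrite -size_cat -lq -lp -last_cat dist_le_path // cat_path pp lp.
Qed.

Lemma dist_sym u v : dist u v = dist v u.
Proof.
wlog suff H : u v / dist u v <= dist v u.
  by apply/eqP; rewrite eqn_leq !H.
have [p [pp _ <- <-]] := geodesicP v u.
have := @dist_le_path (last v p) (rev (belast v p)).
rewrite size_rev size_belast rev_path.
have -> : last (last v p) (rev (belast v p)) = v.
  by case: (p) => //= x s; rewrite rev_cons last_rcons.
by apply; apply: sub_path pp => x y; rewrite adj_sym.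
Qed.

Lemma dist_eq0 u v : dist u v = 0 -> u = v.
Proof. by have [[|x p] [_ _ lastp <-]] := geodesicP u v. Qed.

Lemma dist_step u v : u <> v -> exists2 z, adj u z & (dist z v).+1 = dist u v.
Proof.
move=> uv; have [[|z p] [/= pp _ lp sp]] := geodesicP u v; first by case: uv.
case/andP: pp => uz pp; exists z => //; apply/eqP.
rewrite eqn_leq -{1}sp ltnS -lp dist_le_path //= lp.
have := dist_triangle z u v; have := dist_adj uz; lia.
Qed.

End Distance.

(** * Geodesics in a tree *)

Section Tree.

Variable T : sgraph.
Hypotheses (conT : connected_graph T) (acyT : acyclic_graph T).
Implicit Types (x y z u v w : T) (p q : seq T).

(** If the first steps differ, following one path until it first meets the other, then returning
    along the latter, closes a cycle. *)
Lemma uniq_path_inj x p q :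
  path (@adj T) x p -> path (@adj T) x q -> uniq (x :: p) -> uniq (x :: q) ->
  last x p = last x q -> p = q.
Proof.
elim: p x q => [|u p IH] x q.
  case: q => // w q _ _ _ /= /andP [xq _] lq.
  by move: xq; rewrite lq mem_last.
case: q => [|w q].
  by move=> _ _ /= /andP [xq _] _ lq; move: xq; rewrite -lq mem_last.
move=> pp pq up uq lpq.
case: (eqVneq u w) => [uw|neq].
  subst w; congr (_ :: _); apply: (IH u) => //.
  - by case/andP: pp.
  - by case/andP: pq.
  - by case/andP: up.
  - by case/andP: uq.
set P := u :: p in pp up lpq; set Q := w :: q in pq uq lpq.
have PQ : has (mem Q) P.
  apply/hasP; exists (last x P); first by rewrite /= mem_last.
  by rewrite lpq /= mem_last.
(* The distinct first vertices are remembered so that [P1] and [Q1] cannot both be empty, which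
   makes the cycle longer than 2. *)
have [eP1 eP2] : u = head x P /\ w = head x Q by [].
move: eP1 eP2; clearbody P Q.
case: (split_find PQ) pp up => t P1 P2 tQ nP1 pp up hP hQ.
case/splitPr: tQ pq uq hQ nP1 => Q1 Q2 pq uq hQ nP1.
exfalso; apply: (@acyT (x :: P1 ++ t :: rev Q1)).
  rewrite /= size_cat /= size_rev.
  case: P1 hP {pp up nP1} => [|? ?] /= hP; last by lia.
  case: Q1 hQ {pq uq} => [|? ?] /= hQ; last by lia.
  by rewrite hP hQ eqxx in neq.
move: pp up pq uq.
rewrite cat_rcons !cat_path /= !cat_uniq /= => /and3P [pP1 P1t _] /andP [xP /and3P [uP1 dP uP2]].
move=> /and3P [pQ1 Q1t _] /andP [xQ /and3P [uQ1 dQ uQ2]].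
apply/andP; split.
  rewrite /= rcons_cat cat_path pP1 /= P1t /=.
  have -> : rcons (rev Q1) x = rev (x :: Q1) by rewrite rev_cons.
  have -> : t = last x (rcons Q1 t) by rewrite last_rcons.
  rewrite -[x :: Q1](belast_rcons x Q1 t) rev_path.
  rewrite (@eq_path _ _ (@adj T)) => [|y z]; last by rewrite adj_sym.
  by rewrite rcons_path pQ1.
rewrite /= cat_uniq uP1 /= rev_uniq uQ1 mem_rev.
move: xP xQ; rewrite !mem_cat !inE mem_rev !negb_or => /and3P [-> -> _] /andP [-> _] /=.
move: dQ dP; rewrite !negb_or => /andP [-> _] /andP [-> _] /=.
rewrite andbT; apply: contra nP1 => /hasP [y]; rewrite mem_rev => yQ yP.
by apply/hasP; exists y => //=; rewrite mem_cat yQ.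
Qed.

Lemma dist_uniq_path x p :
  path (@adj T) x p -> uniq (x :: p) -> dist x (last x p) = size p.
Proof.
move=> pp up; have [q [pq uq lq <-]] := geodesicP conT x (last x p).
by rewrite (uniq_path_inj pq pp uq up lq).
Qed.

(** A geodesic to [b] from a closer neighbour of [v] cannot return through [v], so prefixing [v]
    gives the unique simple path from [v] to [b]. *)
Lemma closer_neighbor_inj b v z z' :
  adj v z -> adj v z' -> dist z b < dist v b -> dist z' b < dist v b -> z = z'.
Proof.
have aux y : adj v y -> dist y b < dist v b ->
    exists2 p, path (@adj T) v (y :: p) & uniq (v :: y :: p) /\ last y p = b.
  move=> vy ltd; have [p [pp up lp sp]] := geodesicP conT y b.
  exists p; first by rewrite /= vy.
  split=> //; rewrite [uniq _]/= -/(uniq (y :: p)) up andbT.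
  apply/negP => /splitPl E; case: E pp lp sp {up} => p1 p2 lp1.
  rewrite cat_path last_cat lp1 size_cat => /andP [_ pp2] lb sp.
  have := dist_le_path pp2; rewrite lb; lia.
move=> vz vz' /(aux _ vz) [p pp [up lp]] /(aux _ vz') [q pq [uq lq]].
by have [] : z :: p = z' :: q by apply: uniq_path_inj pp pq up uq _; rewrite /= lp.
Qed.

Definition between u v w := dist u v + dist v w == dist u w.

(** The geodesics from [v] to [a] and to [b] either share their first step, or meet only in [v] and
    join into a simple path through [v]. *)
Lemma between_or_closer a v b :
  between a v b \/ exists z, [/\ adj v z, (dist z a).+1 = dist v a & (dist z b).+1 = dist v b].
Proof.
case: (boolP [exists z, [&& adj v z, (dist z a).+1 == dist v a & (dist z b).+1 == dist v b]]).
  by case/existsP => z /and3P [vz /eqP za /eqP zb]; right; exists z.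
rewrite negb_exists => /forallP nz; left; rewrite /between (dist_sym conT a v).
have [p [pp up la sp]] := geodesicP conT v a; have [q [pq uq lb sq]] := geodesicP conT v b.
have disj w : w \in p -> w \in q -> False.
  move=> wp; case/splitPr: wp pp up la sp => p1 p2 pp up la sp.
  move=> wq; case/splitPr: wq pq uq lb sq => q1 q2 pq uq lb sq.
  (* Both geodesics agree up to a common vertex [w], so they have the same first step, which is
     closer to both ends. *)
  have E : rcons p1 w = rcons q1 w.
    apply: (@uniq_path_inj v); last by rewrite !last_rcons.
    - by move: pp; rewrite -cat_rcons cat_path => /andP [].
    - by move: pq; rewrite -cat_rcons cat_path => /andP [].
    - by move: up; rewrite -cat_rcons -cat_cons cat_uniq => /andP [].
    - by move: uq; rewrite -cat_rcons -cat_cons cat_uniq => /andP [].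
  move: pp pq la lb sp sq; rewrite -!cat_rcons -E.
  set r := rcons p1 w; have : r <> [::] by rewrite /r; case: (p1).
  case: r => // z r _ /= /andP [vz pp] /andP [_ pq] la lb sp sq.
  have := dist_le_path pp; have := dist_le_path pq; rewrite la lb.
  have := dist_triangle conT z v a; have := dist_triangle conT z v b.
  have := dist_adj vz; have := nz z; rewrite vz /=; lia.
have := @dist_uniq_path (last v p) (rev (belast v p) ++ q).
have lr : last (last v p) (rev (belast v p)) = v.
  by case: (p) => //= x s; rewrite rev_cons last_rcons.
rewrite last_cat lr cat_path lr pq rev_path size_cat size_rev size_belast.
rewrite -cat_cons -rev_rcons -lastI la lb sp sq => -> //.
  rewrite andbT; apply: sub_path pp => x y; by rewrite adj_sym.
move: (uq); rewrite cons_uniq => /andP [vq uq']; rewrite cat_uniq rev_uniq up uq' andbT andTb.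
apply/hasP => -[w wq]; rewrite /= mem_rev inE => /predU1P [E|/disj]; last by apply.
by rewrite -E wq in vq.
Qed.

(** Induction on the distance to [c]: the first step from [c] towards [v] and the one towards [w]
    both approach [a], hence coincide, and this neighbour replaces [c]. *)
Lemma between_inj a c v w :
  between a v c -> between a w c -> dist a v = dist a w -> v = w.
Proof.
rewrite /between; move: {2}(dist v c) (erefl (dist v c)) => k.
elim: k c => [|k IH] c dk bv bw eqd.
  by rewrite (dist_eq0 conT dk); apply/esym/(dist_eq0 conT); lia.
have closer y : dist a y + dist y c == dist a c -> dist y c = k.+1 ->
    exists z, [/\ adj c z, dist z a < dist c a, dist z c <= 1, dist y z = k
                & dist a y + dist y z == dist a z].
  move=> by_ dy; have [|z cz dz] := @dist_step T conT c y.
    by move=> E; rewrite E distxx in dy.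
  exists z; have := dist_adj cz; rewrite (dist_sym conT c z).
  have := dist_triangle conT z a c; have := dist_triangle conT y a z.
  move: dz; rewrite (dist_sym conT z y) (dist_sym conT c y) (dist_sym conT z a) (dist_sym conT c a).
  by split => //; lia.
have [z [cz za _ vz bz]] := closer v bv dk.
have [|z' [cz' za' _ wz' bz']] := closer w bw; first by lia.
have E := closer_neighbor_inj cz cz' za za'; subst z'.
exact: (IH z).
Qed.

(** Otherwise the unique neighbour of [v] closer to [b] would be closer to both [a] and [c],
    contradicting that [v] lies between them. *)
Lemma not_between_between a b c v :
  between a v c -> ~~ between a v b -> between b v c.
Proof.
move=> avc avb; case: (between_or_closer a v b) => [H|[z [vz za zb]]]; first by rewrite H in avb.
case: (between_or_closer b v c) => // -[z' [vz' zb' zc']].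
have E : z = z' by apply: (closer_neighbor_inj (b := b)) => //; lia.
subst z'; move: avc; rewrite /between.
have := dist_triangle conT z a c; rewrite !(dist_sym conT a) -za; lia.
Qed.

(** A neighbour of [c] other than the one towards [a] would be beyond [v] and farther from [a]. *)
Lemma farthest_leaf a v c :
  c <> a -> between a v c -> (forall x, between a v x -> dist a x <= dist a c) ->
  c \in leaves T.
Proof.
move=> ca vc maxc; rewrite inE; apply/cards1P.
have [z cz za] := dist_step conT ca; exists z; apply/setP => w; rewrite !inE.
apply/idP/eqP => [cw|->//].
case: (between_or_closer a c w) => [acw|[y [cy ya yw]]].
  have /maxc : between a v w.
    move: vc acw; rewrite /between.
    have := dist_triangle conT c v w; have := dist_triangle conT v a w; lia.
  move: acw; rewrite /between; have : dist c w <> 0.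
    by move/(dist_eq0 conT) => E; rewrite E adj_irrefl in cw.
  lia.
have ?: y = w by apply: (dist_eq0 conT); have := dist_adj cw; lia.
by subst y; apply: (closer_neighbor_inj (b := a)) cw cz _ _; lia.
Qed.

Lemma leaf_beyond a v : v <> a -> exists c, [/\ c \in leaves T, c <> a & between a v c].
Proof.
move=> va; have vv : between a v v by rewrite /between distxx addn0.
case: (arg_maxnP (fun x => dist a x) vv) => c avc maxc; exists c.
have ca : c <> a.
  move=> E; apply: va; apply: (dist_eq0 conT).
  by have := maxc _ vv; rewrite E distxx dist_sym //; lia.
by split => //; apply: farthest_leaf maxc.
Qed.

(** The Gromov product of [a] and [b] at [v]; in a tree, the distance from [v] to the path ab. *)
Definition detour a b v := (dist a v + dist v b - dist a b)./2.

(* Trees are bipartite, so the halving in [detour] is exact. *)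
Lemma dist_detour a b v : dist a v + dist v b = dist a b + 2 * detour a b v.
Proof.
suff [k H] : exists k, dist a v + dist v b = dist a b + 2 * k.
  by rewrite /detour H addKn !mul2n doubleK.
move: {2}(dist v a) (erefl (dist v a)) => k; elim: k v => [|k IH] v dk.
  by exists 0; rewrite (dist_eq0 conT dk) distxx; lia.
case: (between_or_closer a v b) => [/eqP H|[z [_ za zb]]]; first by exists 0; rewrite H; lia.
have [|m H] := IH z; first by lia.
by exists m.+1; rewrite (dist_sym conT a v) -za -zb -(dist_sym conT a z); lia.
Qed.

Lemma betweenE a b v : between a v b = (detour a b v == 0).
Proof. by have := dist_detour a b v; rewrite /between; lia. Qed.

End Tree.

Lemma dist3_le_triameter (G : sgraph) (u v w : G) : dist3 u v w <= triameter G.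
Proof.
by apply: (bigmax_sup u) => //; apply: (bigmax_sup v) => //; apply: (bigmax_sup w).
Qed.

(** * Counting vertices on and off a diametral path *)

Section LowerBound.

Variable T : sgraph.
Hypotheses (conT : connected_graph T) (acyT : acyclic_graph T).
Variables a b : T.
Hypothesis ab_max : forall u v : T, dist u v <= dist a b.
Hypothesis ab_neq : a <> b.

Lemma diametral_leaves : (a \in leaves T) && (b \in leaves T).
Proof.
apply/andP; split.
  apply: (@farthest_leaf T conT acyT b b a) => //; first by rewrite /between distxx.
  by move=> x _; rewrite (dist_sym conT b a).
apply: (@farthest_leaf T conT acyT a a b) => //; first by move/esym.
by rewrite /between distxx.
Qed.

Lemma card_geodesic : #|[set v | between a v b]| <= (dist a b).+1.
Proof.
rewrite -[X in _ <= X]card_ord -(@card_in_imset _ _ (fun v => inord (dist a v) : 'I_(dist a b).+1)).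
  exact: max_card.
move=> v w; rewrite !inE => bv bw /(congr1 val); rewrite /= !inordK ?ltnS ?ab_max //.
exact (between_inj conT acyT bv bw).
Qed.

(* An off-path vertex [v] is determined by [detour a b v] and a leaf beyond  *)
(* it as seen from [a].                                                      *)
Lemma card_off_geodesic h :
  (forall v, detour a b v <= h) ->
  #|[set v | ~~ between a v b]| <= (#|leaves T| - 2) * h.
Proof.
move=> hh; set P := [set v | _].
have /fin_all_exists [f fP] (v : T) : exists c, v \in P ->
    [/\ c \in leaves T, c <> a & between a v c].
  case: (boolP (v \in P)); last by exists v.
  rewrite inE => vP; have [|c H] := @leaf_beyond T conT acyT a v; last by exists c.
  by move=> E; rewrite E /between distxx eqxx in vP.
pose L := leaves T :\ a :\ b.
have cardL : #|L| = #|leaves T| - 2.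
  have /andP [al bl] := diametral_leaves.
  have := cardsD1 a (leaves T); have := cardsD1 b (leaves T :\ a).
  rewrite !inE in al bl *; rewrite al bl; have -> : b != a by apply/eqP => /esym.
  rewrite /L; lia.
pose g v := (f v, inord (detour a b v) : 'I_h.+1).
have ginj : {in P &, injective g}.
  move=> v w vP wP [fvw /(congr1 val)]; rewrite /= !inordK ?ltnS ?hh // => dvw.
  have [_ _ bv] := fP v vP; have [_ _ bw] := fP w wP.
  rewrite fvw in bv; apply: (between_inj conT acyT bv bw) => //.
  move: vP wP; rewrite !inE => vP wP.
  (* As [v] also lies between [b] and the leaf, the leaf fixes the difference of the distances from
     [v] to [a] and [b]; the detour fixes their sum. *)
  have := not_between_between conT acyT bv vP; have := not_between_between conT acyT bw wP.
  have := dist_detour conT acyT a b v; have := dist_detour conT acyT a b w.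
  move: bv bw; rewrite /between !(dist_sym conT b); lia.
rewrite -(card_in_imset ginj) -cardL.
(* Off the path the detour is nonzero, which leaves the [h] values 1, ..., [h]. *)
have cardh : #|[set~ (ord0 : 'I_h.+1)]| = h by rewrite cardsC1 card_ord.
rewrite -[X in _ <= _ * X]cardh -cardsX.
apply/subset_leq_card/subsetP => _ /imsetP [v vP ->].
have [fl fa bv] := fP v vP; move: vP; rewrite inE => vP.
rewrite in_setX in_setC1 !in_setD1 fl /= -val_eqE /= inordK ?ltnS ?hh //.
rewrite -(betweenE conT acyT) vP !andbT.
apply/andP; split; last by apply/eqP.
(* The leaf is not [b], since [v] lies between [a] and the leaf but not between [a] and [b]. *)
by apply: contra vP => /eqP <-.
Qed.

End LowerBound.

Theorem triameter_ge (T : sgraph) (n l : nat) :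
     is_tree T -> #|T| = n -> #|leaves T| = l -> 4 <= n -> 3 <= l ->
     6 * ((n - 1) %/ l) + 2 * minn ((n - 1) %% l) 3 <= triameter T.
Proof.
move=> [conT acyT] <- <- n4 l3.
have /card_gt0P [x0 _] : 0 < #|T| by lia.
case: (@arg_maxnP _ (x0, x0) xpredT (fun p => dist p.1 p.2)) => // -[a b] _ /= maxab.
have ab_max (u v : T) : dist u v <= dist a b by have := maxab (u, v) isT.
have ab_neq : a <> b.
  move=> E; have : #|T| <= 1; last by lia.
  apply/card_le1P => u _ v; rewrite inE; apply/esym/eqP/(dist_eq0 conT).
  by have := ab_max v u; rewrite E distxx; lia.
case: (@arg_maxnP _ a xpredT (detour a b)) => // c _ /= maxc.
set h := detour a b c in maxc.
have hh (v : T) : detour a b v <= h by have := maxc v isT.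
apply: leq_trans (dist3_le_triameter a b c); rewrite /dist3.
have := card_geodesic conT acyT ab_max.
have := card_off_geodesic conT acyT ab_max ab_neq hh.
have := cardsC [set v | between a v b].
have -> : ~: [set v | between a v b] = [set v | ~~ between a v b].
  by apply/setP => v; rewrite !inE.
have := dist_detour conT acyT a b c; rewrite -/h (dist_sym conT c b).
(* Added together, these give 2 h <= D, which settles the case q < h. *)
have := ab_max a c; have := ab_max b c.
have := divn_eq (#|T| - 1) #|leaves T|.
have := ltn_pmod (#|T| - 1) (ltnW (ltnW l3)).
set q := _ %/ _; set r := _ %% _.
case: #|leaves T| l3 => [|[|[|m]]] // _; rewrite !subSS subn0 => ? ? ? ? ? ? ? ?.
have [hq|qh] := leqP h q; last by lia.
(* With l = m + 3, the count reads D + h >= n - 1 - m h, and m h <= m q is the only nonlinear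
   ingredient. *)
by have := leq_mul (leqnn m) hq; lia.
Qed.

(** * The balanced spider attains the bound *)

Section Spider.

(* Vertex [0] is the centre and [i > 0] hangs below [i - l], truncated at 0;  *)
(* so the legs are the residue classes mod [l], and their lengths differ by  *)
(* at most one.                                                              *)
Variables m l : nat.
Hypothesis l_gt0 : 0 < l.

Definition child_of (i j : 'I_m.+1) := (0 < i) && (j == i - l :> nat).

Definition spider_adj (i j : 'I_m.+1) := child_of i j || child_of j i.

Lemma spider_adj_sym : symmetric spider_adj.
Proof. by move=> i j; rewrite /spider_adj orbC. Qed.

Lemma spider_adj_irrefl : irreflexive spider_adj.
Proof. by move=> i; rewrite /spider_adj /child_of; lia. Qed.

Definition spider := SGraph spider_adj_sym spider_adj_irrefl.

Definition parent (i : spider) : spider := inord (i - l).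

Lemma val_parent (i : spider) : parent i = i - l :> nat.
Proof. by rewrite /= inordK // ltnS (leq_trans (leq_subr _ _)) // -ltnS. Qed.

(** The ceiling of i / l. *)
Definition depth (i : nat) := (i + l.-1) %/ l.

Lemma depth_parent (i : spider) : 0 < i -> depth i = (depth (parent i)).+1.
Proof.
move=> i0; rewrite /depth val_parent.
have [li|il] := leqP l i.
  have -> : i + l.-1 = (i - l + l.-1) + l by lia.
  by rewrite divnDr // divnn l_gt0 /= addn1.
have -> : i + l.-1 = i.-1 + l by lia.
rewrite divnDr // divnn l_gt0 /= addn1 (eqP (ltnW il : i - l == 0)) !divn_small //; lia.
Qed.

Lemma path_to_centre (i : spider) :
  exists2 p, path (@adj spider) i p & last i p = ord0 /\ size p = depth i.
Proof.
move: {2}(depth i) (erefl (depth i)) => k.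
elim: k i => [|k IH] i di.
  exists [::] => //=; split => //; apply/val_inj => /=.
  by have := divn_gt0 (i + l.-1) l_gt0; rewrite -/(depth i) di; lia.
have i0 : 0 < i.
  by rewrite lt0n; apply/eqP => i0; move: di; rewrite i0 /depth divn_small //; lia.
have [|p pp [lp sp]] := IH (parent i).
  by move: di; rewrite depth_parent // => -[].
exists (parent i :: p); last by split=> //=; rewrite sp -depth_parent.
by rewrite /= pp andbT; apply/orP; left; rewrite /child_of i0 val_parent eqxx.
Qed.

Lemma spider_connected : connected_graph spider.
Proof.
have root (i : spider) : connect (@adj spider) i ord0.
  by have [p pp [lp _]] := path_to_centre i; apply/connectP; exists p.
move=> i j; apply: connect_trans (root i) _.
by rewrite (sym_connect_sym (@adj_sym spider)).
Qed.

Lemma spider_dist (i j : spider) : dist i j <= depth i + depth j.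
Proof.
apply: leq_trans (dist_triangle spider_connected ord0 i j) _.
rewrite (dist_sym spider_connected ord0 j).
by apply: leq_add; [have [p pp [<- <-]] := path_to_centre i | have [p pp [<- <-]] := path_to_centre j];
  apply: dist_le_path.
Qed.

(* The two neighbours on a cycle of its largest vertex would both be its parent. *)
Lemma spider_acyclic : acyclic_graph spider.
Proof.
move=> c c2 /andP [cc uc].
have [x0 x0c] : exists x, x \in c by case: (c) c2 => // x s _; exists x; rewrite mem_head.
case: (arg_maxnP (fun x : spider => nat_of_ord x) x0c) => x xc maxx.
have [k s rs] := rot_to xc.
have mems y : y \in x :: s -> y <= x by rewrite -rs mem_rot; apply: maxx.
rewrite -(rot_uniq k) rs in uc; rewrite -(rot_cycle k) rs in cc; rewrite -(size_rot k) rs in c2.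
have below y : y \in x :: s -> spider_adj x y -> y = x - l :> nat.
  move/mems => yx; rewrite /spider_adj /child_of => /orP [/andP [_ /eqP //]|].
  by lia.
case: s {rs maxx} cc uc c2 mems below => [//|y s] /=.
rewrite rcons_path => /andP [xy /andP [_ lx]] uc s0 _ below.
have ey : y = x - l :> nat by apply: below => //; rewrite !inE eqxx orbT.
have el : last y s = x - l :> nat.
  by apply: below; [rewrite inE mem_last orbT | rewrite spider_adj_sym].
have E : y = last y s by apply/val_inj; rewrite /= ey el.
have ys : y \notin s by case/and3P: uc.
move: s0 ys E; clear; case: s => [//|z s] _ ys /= E.
by rewrite E mem_last in ys.
Qed.

(** The leaves are the last [l] vertices, those [i] for which the child [i + l] would exceed [m]. *)
Lemma spider_leaves : 2 < l <= m -> #|leaves spider| = l.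
Proof.
move=> /andP [l2 lm].
have leafE (i : spider) : (i \in leaves spider) = (m < i + l).
  rewrite inE; apply/cards1P/idP => [[x /setP nx]|lt_m].
    have nE y : spider_adj i y -> y = x by move=> iy; apply/eqP; have := nx y; rewrite !inE => <-.
    rewrite ltnNge; apply/negP => il.
    have up_lt : i + l < m.+1 by [].
    (* A second neighbour besides [i + l]: the parent or, for the centre, the child 1, which differs
       from the child [l]. *)
    have down_lt : (if i == 0 :> nat then 1 else i - l) < m.+1.
      by have := ltn_ord i; case: ifP; lia.
    have up_adj : spider_adj i (Ordinal up_lt) by rewrite /spider_adj /child_of /=; lia.
    have down_adj : spider_adj i (Ordinal down_lt).
      by rewrite /spider_adj /child_of /=; case: ifP; lia.
    have /(congr1 val) /= : Ordinal up_lt = Ordinal down_lt.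
      exact: etrans (nE _ up_adj) (esym (nE _ down_adj)).
    by case: ifP; lia.
  exists (parent i); apply/setP => y; rewrite !inE.
  rewrite -[y == _]/(y == parent i :> nat) val_parent [LHS]/= /spider_adj /child_of.
  by have := ltn_ord y; lia.
pose f (k : 'I_l) : spider := inord (m - k).
have fE k : f k = m - k :> nat by rewrite inordK // ltnS leq_subr.
have finj : injective f.
  move=> x y /(congr1 (@nat_of_ord _)); rewrite !fE => E; apply/val_inj => /=.
  by have := ltn_ord x; have := ltn_ord y; lia.
rewrite -[RHS](card_ord l) -(card_imset _ finj); apply: eq_card => i; rewrite leafE.
apply/idP/imsetP => [lt_m|[k _ ->]]; last by rewrite fE; have := ltn_ord k; lia.
have ki : m - i < l by have := ltn_ord i; lia.
by exists (Ordinal ki) => //; apply/val_inj; rewrite [RHS]fE /=; have := ltn_ord i; lia.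
Qed.

Lemma spider_triameter : 2 < l <= m -> triameter spider <= 6 * (m %/ l) + 2 * minn (m %% l) 3.
Proof.
move=> /andP [l2 lm]; have := divn_eq m l; have := ltn_pmod m l_gt0.
have : 0 < m %/ l by rewrite divn_gt0.
set q := m %/ l; set r := m %% l => q0 rl mE.
have depth_le (i : spider) : depth i <= q + (q * l < i).
  rewrite -ltnS ltn_divLR //.
  by have := ltn_ord i; case: (ltnP (q * l) i) => /=; lia.
apply/bigmax_leqP => u _; apply/bigmax_leqP => v _; apply/bigmax_leqP => w _.
(* Equal vertices are treated apart: counting one vertex of depth q + 1 twice would overshoot the
   bound when r is small. *)
have dist_le (i j : spider) :
    if i == j :> nat then dist i j = 0 else dist i j <= 2 * q + (q * l < i) + (q * l < j).
  case: ifP => [/eqP /val_inj ->|_]; first exact: distxx.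
  by apply: leq_trans (spider_dist i j) _; have := depth_le i; have := depth_le j; lia.
rewrite /dist3; have := dist_le u v; have := dist_le u w; have := dist_le v w.
have := ltn_ord u; have := ltn_ord v; have := ltn_ord w.
move: (nat_of_ord u) (nat_of_ord v) (nat_of_ord w) => i j k.
move: (dist u v) (dist u w) (dist v w) (q * l) mE q0 rl => duv duw dvw ql mE q0 rl.
clear -mE q0 rl.
by case: (eqVneq i j); case: (eqVneq i k); case: (eqVneq j k); lia.
Qed.

End Spider.

Theorem theorem1p1 :
  (forall (T : sgraph) (n l : nat),
     is_tree T -> #|T| = n -> #|leaves T| = l -> 4 <= n -> 3 <= l ->
     6 * ((n - 1) %/ l) + 2 * minn ((n - 1) %% l) 3 <= triameter T)
  /\
  (forall n l : nat, 4 <= n -> 3 <= l -> l <= n - 1 ->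
     exists T : sgraph,
       [/\ is_tree T, #|T| = n, #|leaves T| = l &
           triameter T = 6 * ((n - 1) %/ l) + 2 * minn ((n - 1) %% l) 3]).
Proof.
split=> [|[//|m] l n4 l3]; first exact: triameter_ge.
rewrite subn1 /= => lm; have l0 : 0 < l by lia.
have lb : 2 < l <= m by rewrite l3.
have treeS : is_tree (spider m l0) by split; [apply: spider_connected | apply: spider_acyclic].
exists (spider m l0); split => //; [exact: card_ord | exact: spider_leaves |].
apply/eqP; rewrite eqn_leq spider_triameter //=.
have := triameter_ge treeS (card_ord _) (spider_leaves l0 lb) n4 l3.
by rewrite subn1.
Qed.
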